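(* Let $n\ge 1$ and let $\Sigma\subset\mathbb R^{n+1}$ be a closed set which is parabolic ADR with constant $M$ and which satisfies the (two-sided) corkscrew condition with constant $\gamma_0\in(0,1)$. Assume in addition that $\Sigma$ is either time-forward ADR with constant $M'$ or time-backward ADR with constant $M'$. Then $\Sigma$ satisfies the weak time-synchronized two cube condition with a constant $\gamma_1\in(0,1)$ depending only on $n,M,\gamma_0,M'$. Furthermore, given $(X,t)\in\Sigma$ with $T_0<t<T_1$ and $0<r<\operatorname{diam}\Sigma$, the two time-synchronized cubes provided by this condition can be chosen to be contained in $Q_r^{+}(X,t)$ if $\Sigma$ is time-forward ADR, and contained in $Q_r^{-}(X,t)$ if $\Sigma$ is time-backward ADR.
   Context: Points of $\mathbb R^{n+1}$ are written $(X,t)$ with $X=(x_1,\dots,x_n)\in\mathbb R^n$, $t\in\mathbb R$. The parabolic distance is $d_p((X,t),(Y,s))=|X-Y|+|t-s|^{1/2}$, and diameters and distances are measured in this metric. The parabolic cube is $Q_r(X,t)=\{(Y,s): |y_i-x_i|<r,\ i=1,\dots,n,\ |t-s|<r^2\}$, with halves $Q_r^+(X,t)=Q_r(X,t)\cap\{s\ge t\}$ and $Q_r^-(X,t)=Q_r(X,t)\cap\{s\le t\}$. For $\eta\ge0$, $\mathcal H^\eta_p$ denotes the $\eta$-dimensional Hausdorff measure defined via coverings whose diameters are measured in $d_p$. For a closed set $\Sigma$, $\sigma=\mathcal H^{n+1}_p$ restricted to $\Sigma$, $\Delta(X,t,r)=\Sigma\cap Q_r(X,t)$, $\Delta^\pm(X,t,r)=\Delta(X,t,r)\cap\{s\ge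 t\}$ resp. $\{s\le t\}$, $T_0=\inf\{t:\exists (X,t)\in\Sigma\}$, $T_1=\sup\{t:\exists(X,t)\in\Sigma\}$. Parabolic ADR with constant $M\ge1$: $M^{-1}r^{n+1}\le\sigma(\Delta(X,t,r))\le Mr^{n+1}$ for all $(X,t)\in\Sigma$ with $T_0<t<T_1$ and $0<r<\operatorname{diam}\Sigma$. Time-forward ADR with constant $M'\ge1$: $\Sigma$ is parabolic ADR, $T_1=\infty$, and $\sigma(\Delta^+(X,t,r))\ge (M')^{-1}r^{n+1}$ for every $(X,t)\in\Sigma$ with $T_0<t$ (and every admissible $r>0$). Time-backward ADR: $\Sigma$ is parabolic ADR, $T_0=-\infty$, and $\sigma(\Delta^-(X,t,r))\ge (M')^{-1}r^{n+1}$ for every $(X,t)\in\Sigma$ with $t<T_1$. Corkscrew condition with constant $\gamma_0\in(0,1)$: for all $(X,t)\in\Sigma$ with $T_0<t<T_1$ and all $0<r<\operatorname{diam}\Sigma$ there are two parabolic cubes $Q_\rho(X_1,t_1),Q_\rho(X_2,t_2)\subset Q_r(X,t)$ with $\gamma_0r\le\rho<r$ such that $Q_\rho(X_1,t_1)\cap(\mathbb R^n\times(T_0,T_1))$ and $Q_\rho(X_2,t_2)\cap(\mathbb R^n\times(T_0,T_1))$ belong to different connected components of $\mathbb R^{n+1}\setminus\Sigma$. Weak time-synchronized two cube condition with constant $\gamma_1\in(0,1)$: the same as the corkscrew condition with $\gamma_0$ replaced by $\gamma_1$ and with the additional requirement $t_1=t_2$. *)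

(* Defs.v *)
From HB Require Import structures.
From mathcomp Require Import all_boot all_order all_algebra.
From mathcomp Require Import all_classical all_reals all_analysis.
Set Implicit Arguments. Unset Strict Implicit. Unset Printing Implicit Defensive.
Import Order.TTheory GRing.Theory Num.Theory.
Import numFieldNormedType.Exports.
Local Open Scope classical_set_scope.
Local Open Scope ring_scope.

Notation pt R n := ('rV[R]_n * R)%type.

Section Parabolic.
Variables (R : realType) (n : nat).

Definition enorm (X : 'rV[R]_n) : R := Num.sqrt (\sum_(i < n) (X ord0 i) ^+ 2).

Definition dp (p q : (pt R n)) : R := enorm (p.1 - q.1) + Num.sqrt `|p.2 - q.2|.

(* parabolic diameter (diam of the empty set is 0) *)
Definition diam_p (A : set (pt R n)) : \bar R :=
  ereal_sup ([set 0%E] `|` [set (dp p q)%:E | p in A & q in A]).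

Definition hausdorff_content (eta delta : R) (A : set (pt R n)) : \bar R :=
  ereal_inf [set (\sum_(0 <= i <oo) ((fine (diam_p (E i))) `^ eta)%:E)%E
            | E in [set E : nat -> set (pt R n) |
                      A `<=` \bigcup_i E i /\ forall i, (diam_p (E i) <= delta%:E)%E]].

Definition hausdorff_p (eta : R) (A : set (pt R n)) : \bar R :=
  ereal_sup [set hausdorff_content eta delta A | delta in [set d : R | 0 < d]].

Definition Qcube (r : R) (p : (pt R n)) : set (pt R n) :=
  [set q : (pt R n) | (forall i, `|q.1 ord0 i - p.1 ord0 i| < r) /\ `|p.2 - q.2| < r ^+ 2].
Definition Qplus (r : R) (p : (pt R n)) : set (pt R n) := Qcube r p `&` [set q | p.2 <= q.2].
Definition Qminus (r : R) (p : (pt R n)) : set (pt R n) := Qcube r p `&` [set q | q.2 <= p.2].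

Variable Sigma : set (pt R n).

Definition sigma_m (A : set (pt R n)) : \bar R := hausdorff_p (n.+1)%:R (Sigma `&` A).

Definition T0 : \bar R := ereal_inf [set q.2%:E | q in Sigma].
Definition T1 : \bar R := ereal_sup [set q.2%:E | q in Sigma].

Definition time_inside (t : R) : Prop := (T0 < t%:E < T1)%E.
Definition strip : set (pt R n) := [set q | time_inside q.2].

Definition admissible_r (r : R) : Prop := 0 < r /\ (r%:E < diam_p Sigma)%E.

Definition parabolic_ADR (M : R) : Prop :=
  forall p, Sigma p -> time_inside p.2 -> forall r, admissible_r r ->
    ((M^-1 * r ^+ n.+1)%:E <= sigma_m (Qcube r p) <= (M * r ^+ n.+1)%:E)%E.

Definition time_forward_ADR (M' : R) : Prop :=
  (exists M, parabolic_ADR M) /\ T1 = +oo%E /\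
  forall p, Sigma p -> (T0 < p.2%:E)%E -> forall r, admissible_r r ->
    ((M'^-1 * r ^+ n.+1)%:E <= sigma_m (Qplus r p))%E.

Definition time_backward_ADR (M' : R) : Prop :=
  (exists M, parabolic_ADR M) /\ T0 = -oo%E /\
  forall p, Sigma p -> (p.2%:E < T1)%E -> forall r, admissible_r r ->
    ((M'^-1 * r ^+ n.+1)%:E <= sigma_m (Qminus r p))%E.

Definition in_different_components (A B : set (pt R n)) : Prop :=
  exists x1 x2, ~ Sigma x1 /\ ~ Sigma x2 /\
    A `<=` connected_component (~` Sigma) x1 /\
    B `<=` connected_component (~` Sigma) x2 /\
    connected_component (~` Sigma) x1 <> connected_component (~` Sigma) x2.

Definition corkscrew (gamma0 : R) : Prop :=
  forall p, Sigma p -> time_inside p.2 -> forall r, admissible_r r ->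
    exists rho X1 t1 X2 t2, gamma0 * r <= rho /\ rho < r /\
      Qcube rho (X1, t1) `<=` Qcube r p /\ Qcube rho (X2, t2) `<=` Qcube r p /\
      in_different_components (Qcube rho (X1, t1) `&` strip)
                              (Qcube rho (X2, t2) `&` strip).

Definition weak_TS_two_cube_in (gamma1 : R) (W : R -> (pt R n) -> set (pt R n)) : Prop :=
  forall p, Sigma p -> time_inside p.2 -> forall r, admissible_r r ->
    exists rho X1 X2 t1, gamma1 * r <= rho /\ rho < r /\
      Qcube rho (X1, t1) `<=` W r p /\ Qcube rho (X2, t1) `<=` W r p /\
      in_different_components (Qcube rho (X1, t1) `&` strip)
                              (Qcube rho (X2, t1) `&` strip).

Definition weak_TS_two_cube (gamma1 : R) : Prop := weak_TS_two_cube_in gamma1 Qcube.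

End Parabolic.

(* Main.v *)
Require Import Defs.
From HB Require Import structures.
From mathcomp Require Import all_boot all_order all_algebra.
From mathcomp Require Import all_classical all_reals all_analysis.
From mathcomp Require Import ring lra.
Import Order.TTheory GRing.Theory Num.Theory.
Import numFieldNormedType.Exports.
Local Open Scope classical_set_scope.
Local Open Scope ring_scope.

Set Implicit Arguments.
Unset Strict Implicit.
Unset Printing Implicit Defensive.

(** Forward time-ADR and upper ADR give, after every point of [Sigma], another
point of [Sigma] that is later by a definite amount.  A two-sided corkscrew at
that point yields two cubes in different components.  If synchronized cubes never
lie in different components, then between the times of these two cubes some time
is "blocked": at it, every small cube over the spatial window meets [Sigma] (if
not, a chain of free cubes would join the two).  A blocked time provides a point
of [Sigma] back over the centre of the window, so the argument repeats and blocked
times occur with gaps much smaller than [r^2].  But a corkscrew cube at scale [r]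
is free of [Sigma] on a time interval of length comparable to [r^2]: contradiction.
The backward case is the same with time reversed, hence the sign [s = 1] or
[s = -1] below. *)

(** * Finite subadditivity of parabolic Hausdorff measure *)

Lemma hausdorff_contentS (R : realType) n (eta delta : R) (A B : set (pt R n)) :
  A `<=` B -> (hausdorff_content eta delta A <= hausdorff_content eta delta B)%E.
Proof.
move=> AB; apply/ereal_infP => _ [E [BE Ed] <-].
by apply: ereal_inf_lbound; exists E => //; split => //; apply: subset_trans BE.
Qed.

Lemma hausdorff_content_ge0 (R : realType) n (eta delta : R) (A : set (pt R n)) :
  (0 <= hausdorff_content eta delta A)%E.
Proof.
apply/ereal_infP => _ [E _ <-]; apply: nneseries_ge0 => i _ _.
by rewrite lee_fin powR_ge0.
Qed.

(** Interleaving almost optimal covers of [A] and [B] gives a cover of the union. Infinite contents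
    are set aside first, since near-optimal covers are extracted from finite infima. *)
Lemma hausdorff_contentU (R : realType) n (eta delta : R) (A B : set (pt R n)) :
  (hausdorff_content eta delta (A `|` B)
     <= hausdorff_content eta delta A + hausdorff_content eta delta B)%E.
Proof.
set a := hausdorff_content _ _ A; set b := hausdorff_content _ _ B.
have a0 : (0 <= a)%E by exact: hausdorff_content_ge0.
have b0 : (0 <= b)%E by exact: hausdorff_content_ge0.
have [aoo|aoo] := eqVneq a +oo%E.
  by rewrite aoo addye ?leey// gt_eqF// (lt_le_trans _ b0).
have [boo|boo] := eqVneq b +oo%E.
  by rewrite boo addey ?leey// gt_eqF// (lt_le_trans _ a0).
have afin : a \is a fin_num by rewrite ge0_fin_numE// ltey.
have bfin : b \is a fin_num by rewrite ge0_fin_numE// ltey.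
apply/lee_addgt0Pr => e e0.
have e20 : 0 < e / 2 by rewrite divr_gt0.
have [_ [E [AE Ed] <-] Ea] := lb_ereal_inf_adherent e20 afin.
have [_ [F [BF Fd] <-] Fb] := lb_ereal_inf_adherent e20 bfin.
rewrite -/a in Ea; rewrite -/b in Fb.
pose G i := if odd i then F i./2 else E i./2.
pose w := fun X : set (pt R n) => ((fine (diam_p X) `^ eta)%:E)%E.
have w0 X : (0 <= w X)%E by rewrite lee_fin powR_ge0.
apply: (@le_trans _ _ (\sum_(0 <= i <oo) w (G i))%E).
  apply: ereal_inf_lbound; exists G => //; split; last first.
    by move=> i; rewrite /G; case: ifP.
  move=> x [/AE[i _ Ex]|/BF[i _ Fx]].
    by exists i.*2 => //; rewrite /G odd_double doubleK.
  by exists i.*2.+1 => //; rewrite /G /= odd_double /= uphalf_double.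
have sumG N : (\sum_(0 <= i < N.*2) w (G i) =
    \sum_(0 <= i < N) w (E i) + \sum_(0 <= i < N) w (F i))%E.
  elim: N => [|N IH]; first by rewrite !big_nil adde0.
  rewrite doubleS !big_nat_recr//= IH /G /= odd_double /= uphalf_double doubleK.
  by rewrite -!addeA; congr (_ + _)%E; rewrite addeCA.
apply: lime_le; first exact: is_cvg_nneseries.
near=> N.
(* The first [N] terms of [G] are dominated by its first [2 N], which are exactly [N] terms of each
   cover. *)
apply: (@le_trans _ _ (\sum_(0 <= i < N.*2) w (G i))%E).
  by apply: lee_sum_nneg_natr => //; rewrite -addnn leq_addr.
rewrite sumG [leRHS](_ : _ = (a + (e/2)%:E) + (b + (e/2)%:E))%E; last first.
  by rewrite [in LHS](splitr e) EFinD addeACA.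
apply: leeD; [apply: le_trans (ltW Ea)|apply: le_trans (ltW Fb)].
  by apply: nneseries_lim_ge => i _ _; exact: w0.
by apply: nneseries_lim_ge => i _ _; exact: w0.
Unshelve. all: by end_near. Qed.

Lemma hausdorff_pS (R : realType) n (eta : R) (A B : set (pt R n)) :
  A `<=` B -> (hausdorff_p eta A <= hausdorff_p eta B)%E.
Proof.
move=> AB; apply/ereal_supP => _ [d d0 <-].
apply: (le_trans (hausdorff_contentS eta d AB)).
by apply: ereal_sup_ubound; exists d.
Qed.

Lemma hausdorff_pU (R : realType) n (eta : R) (A B : set (pt R n)) :
  (hausdorff_p eta (A `|` B) <= hausdorff_p eta A + hausdorff_p eta B)%E.
Proof.
apply/ereal_supP => _ [d d0 <-]; apply: (le_trans (hausdorff_contentU _ _ _ _)).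
by apply: leeD; apply: ereal_sup_ubound; exists d.
Qed.

Lemma hausdorff_p0 (R : realType) n (eta : R) :
  0 < eta -> hausdorff_p eta (@set0 (pt R n)) = 0%E.
Proof.
move=> eta0; have diam0 : diam_p (@set0 (pt R n)) = 0%E.
  rewrite /diam_p (_ : _ `|` _ = [set 0%E]) ?ereal_sup1//.
  by apply/seteqP; split=> x /=; [case=> // -[? []]|left].
apply/eqP; rewrite eq_le; apply/andP; split.
  apply/ereal_supP => _ [d /= d0 <-]; apply: ereal_inf_lbound.
  exists (fun=> set0); first by split => // i; rewrite diam0 lee_fin ltW.
  (* Positivity of [eta] matters: the zeroth power of a zero diameter would be [1]. *)
  by apply: eseries0 => i _ _; rewrite diam0 /= powR0 ?gt_eqF.
apply: (@le_trans _ _ (hausdorff_content eta 1 (@set0 (pt R n)))).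
  exact: hausdorff_content_ge0.
by apply: ereal_sup_ubound; exists 1; rewrite /= ?ltr01.
Qed.

(** Induction over a list of indices, using subadditivity alone, so the pieces may be arbitrary
    sets. *)
Lemma hausdorff_p_finite_cover (R : realType) n (eta : R) (I : finType)
    (A : set (pt R n)) (C : I -> set (pt R n)) (c : R) :
  0 < eta -> A `<=` \bigcup_i C i ->
  (forall i, (hausdorff_p eta (A `&` C i) <= c%:E)%E) ->
  (hausdorff_p eta A <= (#|I|%:R * c)%:E)%E.
Proof.
move=> eta0 AC Cc.
have cover (s : seq I) : (hausdorff_p eta (A `&` [set q | exists2 i, i \in s & C i q])
    <= ((size s)%:R * c)%:E)%E.
  elim: s => [|i s IH] /=.
    rewrite (_ : _ `&` _ = set0) ?hausdorff_p0 ?mul0r//.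
    by apply/seteqP; split=> q //= [_ []].
  rewrite -nat1r mulrDl mul1r EFinD; apply: le_trans (leeD (Cc i) IH).
  apply: le_trans (hausdorff_pU _ _ _); apply: hausdorff_pS => q [Aq [j]].
  rewrite inE => /orP[/eqP -> Cq|js Cq]; first by left.
  by right; split => //; exists j.
rewrite cardE; apply: le_trans (cover _); apply: hausdorff_pS => q Aq; split => //.
by have [i _ Ciq] := AC q Aq; exists i; rewrite ?mem_enum.
Qed.

(** * Parabolic cubes and components of the complement *)

Lemma Qcube_convex (R : realType) n (r : R) (c q : pt R n) (l : R) :
  0 <= l <= 1 -> Qcube r c q -> Qcube r c (c + l *: (q - c)).
Proof.
move=> /andP[l0 l1] [cq tq]; split=> [i|].
  have -> : (c + l *: (q - c)).1 ord0 i - c.1 ord0 i = l * (q.1 ord0 i - c.1 ord0 i).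
    by rewrite [(c + _).1]/(c.1 + l *: (q.1 - c.1)) !mxE addrAC subrr add0r.
  by rewrite normrM ger0_norm// (le_lt_trans _ (cq i))// ler_piMl.
have -> : c.2 - (c + l *: (q - c)).2 = l * (c.2 - q.2).
  by rewrite [(c + _).2]/(c.2 + l * (q.2 - c.2)) opprD addNKr -mulrN opprB.
by rewrite normrM ger0_norm// (le_lt_trans _ tq)// ler_piMl.
Qed.

(** The segment from the centre to [q] is connected and stays in the cube, hence misses [Sigma]. *)
Lemma Qcube_component (R : realType) n (r : R) (Sigma : set (pt R n)) (c q : pt R n) :
  Qcube r c `<=` ~` Sigma -> Qcube r c q ->
  connected_component (~` Sigma) c = connected_component (~` Sigma) q.
Proof.
move=> cS cq; apply: same_connected_component.
have Cf : continuous (fun l : R => c + l *: (q - c)).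
  move=> l; apply: cvgD; first exact: cvg_cst.
  by apply: cvgZr_tmp; exact: cvg_id.
pose B := [set c + l *: (q - c) | l in `[0, 1]%classic].
have Bc : B c by exists 0; rewrite /= ?in_itv/= ?lexx ?ler01// scale0r addr0.
have Bq : B q by exists 1; rewrite /= ?in_itv/= ?lexx ?ler01// scale1r addrC subrK.
apply: (connected_component_max Bc _ _ Bq).
  by move=> z [l /=]; rewrite in_itv/= => l01 <-; apply: cS; apply: Qcube_convex.
apply: connected_continuous_connected (@segment_connected _ _ _) _.
exact: continuous_subspaceT.
Qed.

Lemma Qcube_center (R : realType) n (r : R) (p : pt R n) : 0 < r -> Qcube r p p.
Proof. by move=> r0; split=> [i|]; rewrite subrr normr0 ?exprn_gt0. Qed.

(** Radius is traded for time: shrinking from [b] to [a] leaves [b ^+ 2 - a ^+ 2] of room to move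
    the centre in time. *)
Lemma Qcube_subset (R : realType) n (a b t : R) (y : pt R n) :
  a <= b -> `|t - y.2| <= b ^+ 2 - a ^+ 2 -> Qcube a (y.1, t) `<=` Qcube b y.
Proof.
move=> ab; rewrite ler_norml => /andP[? ?] q [/= qy qt].
split=> [i|]; first exact: lt_le_trans (qy i) _.
by move: qt; rewrite !ltr_norml => /andP[? ?]; apply/andP; split; lra.
Qed.

(** * From mass bounds to points displaced in time *)

Lemma grid_interval (R : realType) (N : nat) (r z : R) :
  (0 < N)%N -> 0 < r -> `|z| < r ->
  exists k : 'I_N, `|z + r - (2 * k%:R + 1) * (r / N%:R)| <= r / N%:R.
Proof.
move=> N0 r0; rewrite ltr_norml => /andP[z1 z2].
have N0R : 0 < N%:R :> R by rewrite ltr0n.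
set d := r / N%:R; have d0 : 0 < d by rewrite divr_gt0.
have rd : r = N%:R * d by rewrite /d mulrC divfK// gt_eqF.
(* The distance from the left end [-r], in cells of width [2 * d]; its integer part is the index of
   the cell. *)
pose y := (z + r) / (2 * d).
have y0 : 0 <= y by rewrite divr_ge0//; lra.
have zy : z + r = y * (2 * d) by rewrite /y divfK//; lra.
have := truncn_itv y0; set k := Num.trunc y => /andP[ky yk].
have kN : (k < N)%N.
  by rewrite -(ltr_nat R) (le_lt_trans ky)// /y ltr_pdivrMr; lra.
exists (Ordinal kN) => /=; rewrite zy; rewrite -natr1 in yk.
by rewrite ler_norml; apply/andP; split; nra.
Qed.

(** One half cube for both time directions: [s = 1] gives [Qplus], [s = -1] gives [Qminus], and
    [s * (t - p.2)] is the time elapsed since [p] in the chosen direction. *)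
Definition Qdir (R : realType) n (s r : R) (p : pt R n) : set (pt R n) :=
  Qcube r p `&` [set q | 0 <= s * (q.2 - p.2)].

(* Otherwise [Sigma] meets the half cube only in a slab of height [(r / N)^2],
   which is covered by [N ^ n] cubes of size [3 r / N]: too little measure. *)
Lemma directed_point (R : realType) n (s M M' : R) (N : nat)
    (Sigma : set (pt R n)) (p : pt R n) (r : R) :
  s = 1 \/ s = -1 -> 1 <= M -> 1 <= M' -> M * M' * 3 ^+ n.+1 < N%:R ->
  parabolic_ADR Sigma M -> admissible_r Sigma r ->
  (forall q, Sigma q -> 0 <= s * (q.2 - p.2) -> time_inside Sigma q.2) ->
  ((M'^-1 * r ^+ n.+1)%:E <= sigma_m Sigma (Qdir s r p))%E ->
  exists q, [/\ Sigma q, Qcube r p q & (r / N%:R) ^+ 2 <= s * (q.2 - p.2)].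
Proof.
move=> hs M1 M'1 hN adr [r0 rdiam] inside low; apply: contrapT => none.
have pow1 : 1 <= (3 : R) ^+ n by rewrite exprn_ege1//; lra.
have N3 : 3 < N%:R :> R.
  apply: le_lt_trans hN; rewrite exprS mulrCA -[leLHS]mulr1 ler_pM2l//.
  by rewrite mulr_ege1// mulr_ege1.
have N0 : (0 < N)%N by rewrite -(ltr_nat R); lra.
have N0R : 0 < N%:R :> R by rewrite ltr0n.
pose d := r / N%:R; have d0 : 0 < d by rewrite divr_gt0.
have rd : r = N%:R * d by rewrite /d mulrC divfK// gt_eqF.
have d3r : 3 * d < r by rewrite rd ltr_pM2r.
have adm3 : admissible_r Sigma (3 * d).
  by split; [lra|rewrite (lt_trans _ rdiam)// lte_fin].
pose C (k : {ffun 'I_n -> 'I_N}) := [set q : pt R n |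
  forall i, `|q.1 ord0 i - p.1 ord0 i + r - (2 * (k i)%:R + 1) * d| <= d].
have cover : Sigma `&` Qdir s r p `<=` \bigcup_k C k.
  move=> q [_ [[qp _] _]].
  have /fin_all_exists[k hk] : forall i, exists k : 'I_N,
      `|q.1 ord0 i - p.1 ord0 i + r - (2 * k%:R + 1) * d| <= d.
    by move=> i; apply: grid_interval.
  by exists [ffun i => k i] => // i; rewrite ffunE.
have small k : (hausdorff_p n.+1%:R (Sigma `&` Qdir s r p `&` C k) <=
    (M * (3 * d) ^+ n.+1)%:E)%E.
  have [->|/set0P[q1 [[Sq1 [Q1 u1]] C1]]] :=
      eqVneq (Sigma `&` Qdir s r p `&` C k) set0.
    rewrite hausdorff_p0// lee_fin mulr_ge0 ?exprn_ge0//; lra.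
  (* Upper ADR is available only at points of [Sigma], so the covering cube is centred at a point
     [q1] of the piece: others differ from it by at most [2 * d] in each coordinate and less than
     [d ^+ 2] in time. *)
  have /andP[_] := adr q1 Sq1 (inside _ Sq1 u1) _ adm3.
  apply: le_trans; apply: hausdorff_pS => q [[Sq [Q u]] Cq]; split => //.
  split=> [i|].
    have := Cq i; have := C1 i; rewrite !ler_norml ltr_norml.
    by move=> /andP[? ?] /andP[? ?]; apply/andP; split; lra.
  have h (q' : pt R n) : Sigma q' -> Qdir s r p q' -> s * (q'.2 - p.2) < d ^+ 2.
    by move=> Sq' [Qq' _]; rewrite ltNge; apply/negP => le; apply: none; exists q'.
  have := h _ Sq1 (conj Q1 u1); have := h _ Sq (conj Q u).
  have : (3 * d) ^+ 2 = 9 * d ^+ 2 by rewrite exprMn; congr (_ * _); ring.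
  move: u u1 => /=; rewrite ltr_norml => u u1 -> ? ?; have := sqr_ge0 d => ?.
  by case: hs => ?; subst s; apply/andP; split; lra.
have := le_trans low (hausdorff_p_finite_cover _ cover small).
rewrite ltr0n => /(_ isT); rewrite card_ffun !card_ord lee_fin; apply/negP.
(* The pieces number [N ^ n] while [r ^+ n.+1] carries [N ^ n.+1]; the spare factor [N] beats
   [M * M' * 3 ^+ n.+1]. *)
rewrite -ltNge natrX [ltRHS]mulrC ltr_pdivlMr; last by lra.
have -> : N%:R ^+ n * (M * (3 * d) ^+ n.+1) * M' =
          (M * M' * 3 ^+ n.+1) * (N%:R ^+ n * d ^+ n.+1) by rewrite exprMn; ring.
have -> : r ^+ n.+1 = N%:R * (N%:R ^+ n * d ^+ n.+1) by rewrite rd exprMn !exprS; ring.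
by rewrite ltr_pM2r// mulr_gt0// exprn_gt0.
Qed.

(** * Blocked times and free corkscrew cubes *)

(* If every time between [t1] and [t2] had a free cube over [D], then, all free
   cubes of one time lying in one component, following free cubes through time
   in steps of [rho^2/2] would connect the two given cubes. *)
Lemma blocked_time (R : realType) n (Sigma : set (pt R n)) (D : set 'rV[R]_n)
    (rho t1 t2 : R) (x1 x2 : 'rV[R]_n) :
  0 < rho ->
  (forall (l : R) x x', 0 <= l <= 1 -> D x -> D x' ->
     let t := t1 + l * (t2 - t1) in
     Qcube (rho / 2) (x, t) `<=` ~` Sigma -> Qcube (rho / 2) (x', t) `<=` ~` Sigma ->
     connected_component (~` Sigma) (x, t) = connected_component (~` Sigma) (x', t)) ->
  D x1 -> D x2 ->
  Qcube rho (x1, t1) `<=` ~` Sigma -> Qcube rho (x2, t2) `<=` ~` Sigma ->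
  connected_component (~` Sigma) (x1, t1) <> connected_component (~` Sigma) (x2, t2) ->
  exists2 l : R, 0 <= l <= 1 &
    forall x, D x -> exists2 q, Sigma q & Qcube rho (x, t1 + l * (t2 - t1)) q.
Proof.
move=> rho0 sync Dx1 Dx2 free1 free2 diff; apply: contrapT => none.
have rho2 : 0 < rho ^+ 2 by rewrite exprn_gt0.
have free_cube (l : R) : 0 <= l <= 1 ->
    exists2 x, D x & Qcube rho (x, t1 + l * (t2 - t1)) `<=` ~` Sigma.
  move=> l01; apply: contrapT => nox; apply: none; exists l => // x Dx.
  apply: contrapT => noq; apply: nox; exists x => // q Qq Sq.
  by apply: noq; exists q.
(* Halving the radius leaves [3 / 4 * rho ^+ 2] of room in time, enough for a step of
   [rho ^+ 2 / 2]; hence the [rho / 2] in the synchronization hypothesis. *)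
have shift (x : 'rV[R]_n) t t' : `|t' - t| <= rho ^+ 2 / 2 ->
    Qcube (rho / 2) (x, t') `<=` Qcube rho (x, t).
  move=> tt'; apply: (@Qcube_subset _ _ _ _ _ (x, t)) => /=; first by lra.
  apply: le_trans tt' _; have -> : (rho / 2) ^+ 2 = rho ^+ 2 / 4 by field.
  by lra.
pose K := (Num.trunc (2 * `|t2 - t1| / rho ^+ 2)).+1.
have K0 : 0 < K%:R :> R by rewrite ltr0n.
have step : `|K%:R^-1 * (t2 - t1)| <= rho ^+ 2 / 2.
  rewrite normrM gtr0_norm ?invr_gt0// mulrC ler_pdivrMr//.
  have /andP[_] := @truncn_itv _ (2 * `|t2 - t1| / rho ^+ 2)
    (divr_ge0 (mulr_ge0 (ler0n R 2) (normr_ge0 _)) (ltW rho2)).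
  by rewrite -/K ltr_pdivrMr// => ?; nra.
(* Interpolating from [t1] to [t2] requires no order between them. *)
pose time k := t1 + k%:R / K%:R * (t2 - t1).
have follow k : (k <= K)%N -> forall x, D x -> Qcube rho (x, time k) `<=` ~` Sigma ->
    connected_component (~` Sigma) (x1, t1) = connected_component (~` Sigma) (x, time k).
  have lK j : (j <= K)%N -> 0 <= (j%:R / K%:R : R) <= 1.
    by move=> jK; rewrite divr_ge0 ?ler0n//= ler_pdivrMr// mul1r ler_nat.
  have self (x : 'rV[R]_n) t : Qcube (rho / 2) (x, t) `<=` Qcube rho (x, t).
    by apply: shift; rewrite subrr normr0; lra.
  elim: k => [|k IH] kK x Dx free.
    have t0 : time 0%N = t1 by rewrite /time !mul0r addr0.
    rewrite t0 in free *; have := sync 0 x1 x; rewrite lexx ler01 mul0r addr0.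
    by apply => //; [apply: subset_trans free1|apply: subset_trans free]; apply: self.
  have [y Dy freey] := free_cube _ (lK k (ltnW kK)).
  have near_y : Qcube (rho / 2) (y, time k.+1) `<=` Qcube rho (y, time k).
    apply: shift; rewrite (_ : _ - _ = K%:R^-1 * (t2 - t1))//.
    by rewrite /time -natr1; ring.
  (* Two moves: forward in time inside the free cube over [y], then across to [x] at the new time by
     synchronization. *)
  rewrite (IH (ltnW kK) y Dy freey).
  rewrite (Qcube_component freey (near_y _ (Qcube_center _ _))); last by lra.
  apply: sync => //; [exact: lK|exact: subset_trans freey|].
  by apply: subset_trans free; apply: self.
have timeK : time K = t2 by rewrite /time divff ?gt_eqF// mul1r addrC subrK.
by apply: diff; have := follow K (leqnn K) x2 Dx2; rewrite timeK; apply.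
Qed.

(** The corkscrew condition controls its cubes only inside the strip. Since [q] lies at least
    [r ^+ 2] beyond [t], all of [Qcube r q] is in the strip, so the cubes miss [Sigma] entirely. *)
Lemma corkscrew_free_cubes (R : realType) n (s g : R) (Sigma : set (pt R n))
    (t r : R) (q : pt R n) :
  s = 1 \/ s = -1 -> 0 < g -> corkscrew Sigma g ->
  (forall t', 0 <= s * (t' - t) -> time_inside Sigma t') ->
  Sigma q -> admissible_r Sigma r -> r ^+ 2 <= s * (q.2 - t) ->
  exists b y1 y2, [/\ g * r <= b /\ 0 < b, Qcube r q y1, Qcube r q y2 &
    [/\ Qcube b y1 `<=` ~` Sigma, Qcube b y2 `<=` ~` Sigma &
      connected_component (~` Sigma) y1 <> connected_component (~` Sigma) y2]].
Proof.
move=> hs g0 cork inside Sq adm_r rq; have r0 := adm_r.1.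
have in_strip y : Qcube r q y -> strip Sigma y.
  move=> [_]; rewrite ltr_norml => /andP[? ?]; apply: inside.
  by case: hs => ?; subst s; lra.
have q_in : time_inside Sigma q.2 by apply: in_strip; apply: Qcube_center.
have [b [x1 [t1 [x2 [t2 [gb [br [Q1 [Q2 [z1 [z2 [Sz1 [Sz2 [C1 [C2 ne]]]]]]]]]]]]]]] :=
  cork q Sq q_in r adm_r.
have b0 : 0 < b by rewrite (lt_le_trans _ gb)// mulr_gt0.
have D1 : Qcube b (x1, t1) `<=` connected_component (~` Sigma) z1.
  by move=> y Qy; apply: C1; split => //; exact/in_strip/Q1.
have D2 : Qcube b (x2, t2) `<=` connected_component (~` Sigma) z2.
  by move=> y Qy; apply: C2; split => //; exact/in_strip/Q2.
have c1 := Qcube_center (x1, t1) b0; have c2 := Qcube_center (x2, t2) b0.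
exists b, (x1, t1), (x2, t2); split => //; [exact: Q1|exact: Q2|split].
- by move=> y /D1; exact: connected_component_sub.
- by move=> y /D2; exact: connected_component_sub.
- move=> e; apply: ne.
  by rewrite (same_connected_component (D1 _ c1)) e (same_connected_component (D2 _ c2)).
Qed.

(** * Synchronized cubes and the chain of blocked times *)

Lemma Qcube_time (R : realType) n (s t a : R) (q q' : pt R n) :
  s = 1 \/ s = -1 -> Qcube a q q' -> `|s * (q'.2 - t) - s * (q.2 - t)| < a ^+ 2.
Proof.
move=> hs [_]; rewrite !ltr_norml => /andP[? ?].
by case: hs => ->; apply/andP; split; lra.
Qed.

Definition xcube (R : realType) n (a : R) (X : 'rV[R]_n) : set 'rV[R]_n :=
  [set x | forall i, `|x ord0 i - X ord0 i| < a].

Lemma xcube_le (R : realType) n (a a' : R) (X x : 'rV[R]_n) :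
  xcube a X x -> a <= a' -> xcube a' X x.
Proof. by move=> ax aa' i; apply: lt_le_trans aa'. Qed.

Lemma xcube_add (R : realType) n (a a' : R) (X : 'rV[R]_n) (q q' : pt R n) :
  xcube a X q.1 -> Qcube a' q q' -> xcube (a + a') X q'.1.
Proof.
move=> qp [qq' _] i; have := qp i; have := qq' i; rewrite !ltr_norml.
by move=> /andP[? ?] /andP[? ?]; apply/andP; split; lra.
Qed.

Lemma convex_between (R : realFieldType) (l a b x y : R) :
  0 <= l <= 1 -> a <= x <= b -> a <= y <= b -> a <= (1 - l) * x + l * y <= b.
Proof.
by move=> /andP[? ?] /andP[? ?] /andP[? ?]; apply/andP; split; nra.
Qed.

(** Otherwise the two cubes would be a forbidden synchronized pair. The window [r / 2] and the
    bounds on elapsed time keep both inside [Qdir s r p], as [rho ^+ 2 < r ^+ 2 / 2]. *)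
Lemma same_time_component (R : realType) n (s gamma r rho : R) (Sigma : set (pt R n))
    (p : pt R n) :
  s = 1 \/ s = -1 -> 0 < rho -> gamma * r <= rho -> rho <= r / 2 ->
  ~ (exists rho X1 X2 t1, gamma * r <= rho /\ rho < r /\
      Qcube rho (X1, t1) `<=` Qdir s r p /\ Qcube rho (X2, t1) `<=` Qdir s r p /\
      in_different_components Sigma (Qcube rho (X1, t1) `&` strip Sigma)
                                    (Qcube rho (X2, t1) `&` strip Sigma)) ->
  forall x x' t, xcube (r / 2) p.1 x -> xcube (r / 2) p.1 x' ->
    rho ^+ 2 <= s * (t - p.2) <= r ^+ 2 / 2 ->
    Qcube rho (x, t) `<=` ~` Sigma -> Qcube rho (x', t) `<=` ~` Sigma ->
    connected_component (~` Sigma) (x, t) = connected_component (~` Sigma) (x', t).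
Proof.
move=> hs rho0 gr rhor noTS x x' t Dx Dx' /andP[ut1 ut2] fx fx'.
apply: contrapT => ne; apply: noTS.
have rho2 : rho ^+ 2 < r ^+ 2 / 2 by nra.
have sub y : xcube (r / 2) p.1 y -> Qcube rho (y, t) `<=` Qdir s r p.
  move=> Dy q Qq; have := Qcube_time p.2 hs Qq.
  have Dq := xcube_add (q := (y, t)) Dy Qq.
  rewrite ltr_norml /= => /andP[? ?]; split; last by rewrite /=; lra.
  split=> [i|]; first by apply: lt_le_trans (Dq i) _; lra.
  rewrite ltr_norml; apply/andP.
  by case: hs => ?; subst s; split; lra.
exists rho, x, x', t; split => //; split; first by lra.
split; first exact: sub.
split; first exact: sub.
exists (x, t), (x', t); split; first exact/fx/Qcube_center.
split; first exact/fx'/Qcube_center.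
split; last split => //.
  move=> y [Qy _]; rewrite (Qcube_component fx Qy).
  by apply: connected_component_refl; exact: fx.
move=> y [Qy _]; rewrite (Qcube_component fx' Qy).
by apply: connected_component_refl; exact: fx'.
Qed.

(* The free cube around [y] keeps blocked times away from that of [y], so a step
   of length at most [5/4 m^2] cannot get past it. *)
Lemma next_blocked_point (R : realType) n (s g r m r1 b v : R) (Sigma : set (pt R n))
    (p q y : pt R n) :
  s = 1 \/ s = -1 -> 0 < g < 1 -> corkscrew Sigma g ->
  (forall t, 0 <= s * (t - p.2) -> time_inside Sigma t) ->
  (forall x x' t, xcube (r / 2) p.1 x -> xcube (r / 2) p.1 x' ->
    (g * r1 / 2) ^+ 2 <= s * (t - p.2) <= r ^+ 2 / 2 ->
    Qcube (g * r1 / 2) (x, t) `<=` ~` Sigma -> Qcube (g * r1 / 2) (x', t) `<=` ~` Sigma ->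
    connected_component (~` Sigma) (x, t) = connected_component (~` Sigma) (x', t)) ->
  0 < r1 -> r1 <= m / 2 -> m <= r / 16 -> 2 * m <= b -> admissible_r Sigma r1 ->
  Qcube b y `<=` ~` Sigma -> xcube (r / 2) p.1 y.1 ->
  s * (y.2 - p.2) + 5 / 4 * m ^+ 2 <= r ^+ 2 / 2 ->
  Sigma q -> xcube (g * r1 + m) p.1 q.1 -> 0 <= v < s * (y.2 - p.2) ->
  v + 4 * r1 ^+ 2 <= s * (q.2 - p.2) < v + m ^+ 2 ->
  exists q', [/\ Sigma q', xcube (g * r1) p.1 q'.1 &
    v + r1 ^+ 2 <= s * (q'.2 - p.2) < s * (y.2 - p.2)].
Proof.
move=> hs /andP[g0 g1] cork inside sync r10 r1m mr mb adm1 free_y near_y uyr Sq near_q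
  /andP[v0 vy] /andP[vq qv].
pose rho := g * r1; rewrite -/rho in sync near_q *.
have rho0 : 0 < rho by rewrite mulr_gt0.
have rhor1 : rho <= r1 by rewrite /rho; nra.
have r1m2 : r1 ^+ 2 <= m ^+ 2 / 4 by clear -r1m r10; nra.
have rho2 : rho ^+ 2 <= r1 ^+ 2 by clear -rho0 rhor1; nra.
have b2 : 4 * m ^+ 2 <= b ^+ 2 by clear -mb r1m r10; nra.
have r120 : 0 < r1 ^+ 2 by rewrite exprn_gt0.
have q_late : r1 ^+ 2 <= s * (q.2 - p.2) by lra.
have [c [[x1 t1] [[x2 t2] [[gc c0] Q1 Q2 [f1 f2 ne]]]]] :=
  corkscrew_free_cubes hs g0 cork inside Sq adm1 q_late.
rewrite -/rho in gc.
have near x t : Qcube r1 q (x, t) -> xcube (r / 2) p.1 x.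
  by move=> Qx; apply: xcube_le (xcube_add near_q Qx) _; lra.
(* The corkscrew centres differ in time from [q] by less than [r1 ^+ 2], which is at most
   [m ^+ 2 / 4]; this gives both the [3] and the [5 / 4]. *)
have time_between l : 0 <= l <= 1 ->
    v + 3 * r1 ^+ 2 <= s * (t1 + l * (t2 - t1) - p.2) <= v + 5 / 4 * m ^+ 2.
  move=> l01; have -> : s * (t1 + l * (t2 - t1) - p.2) =
      (1 - l) * (s * (t1 - p.2)) + l * (s * (t2 - p.2)) by ring.
  have := Qcube_time p.2 hs Q1; have := Qcube_time p.2 hs Q2.
  rewrite !ltr_norml /= => /andP[? ?] /andP[? ?].
  by apply: convex_between => //; apply/andP; split; lra.
have free x t : Qcube c (x, t) `<=` ~` Sigma -> Qcube rho (x, t) `<=` ~` Sigma.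
  apply: subset_trans; apply: (@Qcube_subset _ _ _ _ _ (x, t)) => //=.
  by rewrite subrr normr0 subr_ge0; clear -gc rho0; nra.
have [l x x' l01 Dx Dx'|l l01 blocked] := blocked_time rho0 _ (near _ _ Q1) (near _ _ Q2)
    (free _ _ f1) (free _ _ f2) ne.
  apply: sync => //; have /andP[? ?] := time_between l l01.
  have -> : (rho / 2) ^+ 2 = rho ^+ 2 / 4 by field.
  by apply/andP; split; lra.
move: (time_between l l01) blocked; set t := t1 + _ => /andP[vt tv] blocked.
(* Using the blocked time over [p.1] rather than [q.1] keeps spatial drift from accumulating along
   the chain. *)
have [|q' Sq' Qq'] := blocked p.1; first by move=> i; rewrite subrr normr0; lra.
have := Qcube_time p.2 hs Qq'; rewrite ltr_norml /= => /andP[? ?].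
exists q'; split => //; first exact: Qq'.1.
apply/andP; split; first by lra.
(* If [q'] reached the time of [y], then [t] would be within [5 / 4 * m ^+ 2] of it. As [b ^+ 2] is
   at least [4 * m ^+ 2], the blocked cube over [y.1] would fit in the free cube, yet it meets
   [Sigma]. *)
rewrite ltNge; apply/negP => late.
have [q2 Sq2 Qq2] := blocked y.1 near_y.
apply: free_y Sq2; apply: Qcube_subset Qq2; first by lra.
by rewrite ler_norml; case: hs => ?; subst s; apply/andP; split; lra.
Qed.

(** Without a synchronized pair, points of [Sigma] near the time axis through [p] advance by at
    least [r1 ^+ 2] per step but never reach the time of a fixed free cube. *)
Lemma directed_two_cube (R : realType) n (s M M' g : R) (N : nat)
    (Sigma : set (pt R n)) :
  s = 1 \/ s = -1 -> 1 <= M -> 1 <= M' -> 0 < g < 1 -> M * M' * 3 ^+ n.+1 < N%:R ->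
  parabolic_ADR Sigma M -> corkscrew Sigma g ->
  (forall t t', time_inside Sigma t -> 0 <= s * (t' - t) -> time_inside Sigma t') ->
  (forall p, Sigma p -> time_inside Sigma p.2 -> forall r, admissible_r Sigma r ->
    ((M'^-1 * r ^+ n.+1)%:E <= sigma_m Sigma (Qdir s r p))%E) ->
  weak_TS_two_cube_in Sigma ((g / N%:R) ^+ 2 / 64) (@Qdir R n s).
Proof.
move=> hs M1 M'1 /andP[g0 g1] hN adr cork upward low p Sp p_in r adm_r.
have [r0 rdiam] := adm_r.
have N1 : 1 <= N%:R :> R.
  apply: ltW; apply: le_lt_trans hN.
  by rewrite mulr_ege1 ?exprn_ege1 ?mulr_ege1//; lra.
have N0 : N%:R != 0 :> R by rewrite gt_eqF//; lra.
have inside t : 0 <= s * (t - p.2) -> time_inside Sigma t by exact: upward.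
have inside_after (q : pt R n) : 0 <= s * (q.2 - p.2) ->
    forall q', Sigma q' -> 0 <= s * (q'.2 - q.2) -> time_inside Sigma q'.2.
  by move=> uq q' _ ?; apply: inside; lra.
have upp : s * (p.2 - p.2) = 0 by rewrite subrr mulr0.
have upp0 : 0 <= s * (p.2 - p.2) by rewrite upp.
have adm (a : R) : 0 < a -> a <= r -> admissible_r Sigma a.
  by move=> a0 ar; split => //; rewrite (le_lt_trans _ rdiam)// lee_fin.
(* Corkscrews are used at scale [r2] for the barrier and [r1] for each chain step. The barrier has
   radius at least [g * r2 = 2 * m], and [directed_point] at scale [m] gains [4 * r1 ^+ 2] in time.
   Then [g * r1 / 2] is exactly the claimed constant times [r]. *)
pose r2 := r / N%:R / 8; pose m := g * r2 / 2; pose r1 := m / N%:R / 2.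
have divN (a : R) : 0 < a -> 0 < a / N%:R <= a.
  by move=> a0; rewrite divr_gt0 ?ler_pdivrMr ?ler_peMr ?(ltW a0)//; lra.
have /andP[rN0 rNr] := divN r r0.
have [r20 r2r] : 0 < r2 /\ r2 <= r / 8 by rewrite /r2; split; lra.
have [m0 mr2] : 0 < m /\ m <= r2 / 2 by rewrite /m; split; nra.
have /andP[mN0 mNm] := divN m m0.
have [r10 r1m] : 0 < r1 /\ r1 <= m / 2 by rewrite /r1; split; lra.
have r2E : (r / 4 / N%:R) ^+ 2 = 4 * r2 ^+ 2 by rewrite /r2; field.
have r1E : (m / N%:R) ^+ 2 = 4 * r1 ^+ 2 by rewrite /r1; field.
have gamma_le : (g / N%:R) ^+ 2 / 64 * r <= g * r1 / 2.
  by rewrite le_eqVlt; apply/orP; left; apply/eqP; rewrite /r1 /m /r2; field.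
have gr2 : g * r2 = 2 * m by rewrite /m; field.
clearbody r1; clearbody m; clearbody r2.
clear divN rN0 rNr mN0 mNm.
have rho0 : 0 < g * r1 / 2 by rewrite !mulr_gt0 ?invr_gt0.
have rhor : g * r1 / 2 <= r / 2 by clear -g0 g1 r10 r1m mr2 r2r r0; nra.
have r120 : 0 < r1 ^+ 2 by rewrite exprn_gt0.
have r220 : 0 < r2 ^+ 2 by rewrite exprn_gt0.
have r22 : r2 ^+ 2 <= r ^+ 2 / 64 by clear -r20 r2r; nra.
have m2 : m ^+ 2 <= r2 ^+ 2 / 4 by clear -m0 mr2; nra.
have adm4 : admissible_r Sigma (r / 4) by apply: adm; lra.
have adm_r2 : admissible_r Sigma r2 by apply: adm; lra.
have adm_m : admissible_r Sigma m by apply: adm; lra.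
have adm_r1 : admissible_r Sigma r1 by apply: adm; lra.
apply: contrapT => noTS.
have sync := same_time_component hs rho0 gamma_le rhor noTS.
(* Scale [r / 4] leaves room for the barrier centre [y] to stay in the spatial window [r / 2], and
   its time below [r ^+ 2 / 2] with a margin for one chain step. *)
have [p0 [Sp0 Qp0]] := directed_point hs M1 M'1 hN adr adm4
  (inside_after p upp0) (low p Sp p_in _ adm4).
rewrite r2E => up0.
have up0' : r2 ^+ 2 <= s * (p0.2 - p.2) by lra.
have [b [y [_ [[gb b0] Qy _ [free_y _ _]]]]] :=
  corkscrew_free_cubes hs g0 cork inside Sp0 adm_r2 up0'.
have near_y : xcube (r / 2) p.1 y.1.
  by apply: xcube_le (xcube_add Qp0.1 Qy) _; lra.
have [uy0 uyr] : 0 < s * (y.2 - p.2) /\ s * (y.2 - p.2) < r ^+ 2 / 16 + r2 ^+ 2.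
  have := Qcube_time p.2 hs Qp0; have := Qcube_time p.2 hs Qy; rewrite !ltr_norml upp.
  have -> : (r / 4) ^+ 2 = r ^+ 2 / 16 by field.
  by move=> /andP[? ?] /andP[? ?]; split; lra.
have chain k : exists q, [/\ Sigma q, xcube (g * r1) p.1 q.1 &
    k%:R * r1 ^+ 2 <= s * (q.2 - p.2) < s * (y.2 - p.2)].
  elim: k => [|k [q [Sq near_q /andP[kq qy]]]].
    exists p; split => //; first by move=> i; rewrite subrr normr0; lra.
    by rewrite upp mul0r lexx.
  have uq0 : 0 <= s * (q.2 - p.2) by apply: le_trans kq; rewrite mulr_ge0 ?sqr_ge0.
  (* The point [q1] is late enough for a corkscrew at scale [r1] to stay after [q], and within
     [m ^+ 2] in time so that the barrier cannot be jumped. *)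
  have [q1 [Sq1 Qq1]] := directed_point hs M1 M'1 hN adr adm_m
    (inside_after q uq0) (low q Sq (inside _ uq0) _ adm_m).
  rewrite r1E => uq1; have := Qcube_time p.2 hs Qq1; rewrite ltr_norml => /andP[_ uq1m].
  have [||||||q' [Sq' near_q' /andP[qq' q'y]]] := @next_blocked_point _ _ s g r m r1 b
    (s * (q.2 - p.2)) Sigma p q1 y hs _ cork inside sync r10 r1m _ _ adm_r1 free_y near_y _ Sq1
    (xcube_add near_q Qq1).
  - by rewrite g0.
  - by lra.
  - by lra.
  - by lra.
  - by rewrite uq0.
  - by apply/andP; split; lra.
  by exists q'; split => //; rewrite q'y -natr1 mulrDl mul1r andbT; lra.
(* More steps than [s * (y.2 - p.2) / r1 ^+ 2] would carry the chain past [y]. *)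
have [q [_ _ /andP[kq qy]]] := chain (Num.trunc (s * (y.2 - p.2) / r1 ^+ 2)).+1.
have /andP[_] := truncn_itv (divr_ge0 (ltW uy0) (ltW r120)).
by rewrite ltr_pdivrMr// => ?; lra.
Qed.

(** * Specialization to the two time directions *)

Lemma Qdir_plus (R : realType) n (r : R) (p : pt R n) : Qdir 1 r p = Qplus r p.
Proof. by congr (_ `&` _); apply/funext => q /=; rewrite mul1r subr_ge0. Qed.

Lemma Qdir_minus (R : realType) n (r : R) (p : pt R n) : Qdir (-1) r p = Qminus r p.
Proof. by congr (_ `&` _); apply/funext => q /=; rewrite mulN1r opprB subr_ge0. Qed.

Lemma weak_TS_two_cube_inS (R : realType) n (gamma : R) (Sigma : set (pt R n))
    (W W' : R -> pt R n -> set (pt R n)) :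
  (forall r p, W r p `<=` W' r p) ->
  weak_TS_two_cube_in Sigma gamma W -> weak_TS_two_cube_in Sigma gamma W'.
Proof.
move=> WW' TS p Sp pin r adm_r.
have [rho [X1 [X2 [t1 [gr [rhor [Q1 [Q2 diff]]]]]]]] := TS p Sp pin r adm_r.
exists rho, X1, X2, t1; do 2!split => //.
by split; [apply: subset_trans Q1 _|split => //; apply: subset_trans Q2 _].
Qed.

Unset Implicit Arguments.

Theorem theorem3p1 (R : realType) (n : nat) (M gamma0 M' : R) :
  (1 <= n)%N -> 1 <= M -> 0 < gamma0 < 1 -> 1 <= M' ->
  exists gamma1 : R, 0 < gamma1 < 1 /\
    forall Sigma : set (pt R n),
      closed Sigma ->
      parabolic_ADR Sigma M ->
      corkscrew Sigma gamma0 ->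
      (time_forward_ADR Sigma M' \/ time_backward_ADR Sigma M') ->
      weak_TS_two_cube Sigma gamma1 /\
      (time_forward_ADR Sigma M' -> weak_TS_two_cube_in Sigma gamma1 (@Qplus R n)) /\
      (time_backward_ADR Sigma M' -> weak_TS_two_cube_in Sigma gamma1 (@Qminus R n)).
Proof.
move=> _ M1 /andP[g0 g1] M'1.
(* [N] is fixed before [Sigma], so the constant depends only on [n], [M], [gamma0] and [M']. *)
pose x := M * M' * 3 ^+ n.+1; pose N := (Num.trunc x).+1.
have x0 : 0 <= x by rewrite !mulr_ge0 ?exprn_ge0//; lra.
have /andP[_ hN] : _ <= x < N%:R := truncn_itv x0.
have N1 : 1 <= N%:R :> R by rewrite ler1n.
have gN : 0 < gamma0 / N%:R < 1.
  by rewrite divr_gt0 ?ltr_pdivrMr ?(lt_le_trans ltr01 N1)//; lra.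
exists ((gamma0 / N%:R) ^+ 2 / 64); split.
  by case/andP: gN => ? ?; apply/andP; split; nra.
move=> Sigma _ adr cork dir.
have g01 : 0 < gamma0 < 1 by rewrite g0.
have fwd : time_forward_ADR Sigma M' ->
    weak_TS_two_cube_in Sigma ((gamma0 / N%:R) ^+ 2 / 64) (@Qplus R n).
  move=> [_ [T1oo low]]; apply: (@weak_TS_two_cube_inS _ _ _ _ (Qdir 1)).
    by move=> r p; rewrite Qdir_plus.
  apply: (directed_two_cube (or_introl erefl) M1 M'1 g01 hN adr cork).
    (* Since [T1] is infinite, every time after an interior time is interior; the backward case uses
       [T0] likewise. *)
    move=> t t' /andP[t0 _]; rewrite mul1r subr_ge0 => tt'.
    by rewrite /time_inside T1oo ltry andbT (lt_le_trans t0)// lee_fin.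
  by move=> p Sp /andP[p0 _] r adm_r; rewrite Qdir_plus; exact: low.
have bwd : time_backward_ADR Sigma M' ->
    weak_TS_two_cube_in Sigma ((gamma0 / N%:R) ^+ 2 / 64) (@Qminus R n).
  move=> [_ [T0oo low]]; apply: (@weak_TS_two_cube_inS _ _ _ _ (Qdir (-1))).
    by move=> r p; rewrite Qdir_minus.
  apply: (directed_two_cube (or_intror erefl) M1 M'1 g01 hN adr cork).
    move=> t t' /andP[_ t1]; rewrite mulN1r opprB subr_ge0 => tt'.
    by rewrite /time_inside T0oo ltNyr /= (le_lt_trans _ t1)// lee_fin.
  by move=> p Sp /andP[_ p1] r adm_r; rewrite Qdir_minus; exact: low.
split=> //; case: dir => [/fwd|/bwd];
  by apply: weak_TS_two_cube_inS => r p; exact: subIsetl.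
Qed.
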